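(* Let $p$ be an odd prime, $L=\mathbb F_{p^m}$, $\sigma=p^s$ with $0<s<m$, $K_1=\{x\in L:x^\sigma=x\}$, and consider the presemifield $B(p,m,s,l,n,N)$. Suppose that $n^{\sigma-1}\ne N$, $n^{\sigma-1}\neq N^2$, and that $\sigma^2\ne1$ on $L$ (i.e. $x\mapsto x^{\sigma^2}$ is not the identity on $L$). Put $$\alpha_0=\frac{n^{\sigma}-n^2N^2}{n(nN^2-n^{\sigma})},\qquad \alpha_1=\frac{n^{\sigma}+n^2N^2-nN-n^{\sigma+1}N}{n(nN^2-n^{\sigma})},\qquad \alpha_2=\frac{nN(n^{\sigma}-1)}{n(nN^2-n^{\sigma})},$$ and let $\mathbb W\subseteq L$ be the kernel of the $K_1$-linear map $L\to L$, $$t\mapsto(1+n\alpha_0)t+(1+n\alpha_1+nN\alpha_0^{\sigma})t^{\sigma}+(n\alpha_2+nN\alpha_1^{\sigma})t^{\sigma^2}+nN\alpha_2^{\sigma}t^{\sigma^3}.$$ Then the middle nucleus $\mathbb N_m$ of the associated semifield satisfies $$\dim_{K_1}\mathbb N_m=1+\dim_{K_1}\mathbb W\le4.$$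
   Context: A finite presemifield $(F,+,* )$ is a finite abelian group $(F,+)$ with a multiplication satisfying both distributive laws and such that $x*y=0$ implies $x=0$ or $y=0$; a semifield is a presemifield with identity. For an integer $k\ge0$, $L^k=\{x^k:x\in L\}$. $B(p,m,s,l,n,N)$ is defined for $l,n,N\in L^*$ with $-l\notin L^{\sigma-1}$ and $x^{\sigma+1}+(1-1/N)x+(1/n-1)/N\ne0$ for all $x\in L$: it is $F=L^2$ with multiplication $(a,b)*(c,d)=(h(a,b,c,d),\,ad+bc)$, where $$h(a,b,c,d)=ac^{\sigma}-nNbd^{\sigma}+l(a^{\sigma}c-nNb^{\sigma}d)+n\{Nad^{\sigma}-bc^{\sigma}+l(a^{\sigma}d-Nb^{\sigma}c)\}.$$ Associated semifield: put $e=(1,0)$, define $\beta,\gamma\colon F\to F$ by $e*\beta(x)=x$ and $\gamma(x)*e=e*x$, and set $x\circ y=\beta(\gamma(x)*y)$. Then $(F,+,\circ)$ is a semifield isotopic to $(F,+,* )$ with identity $e$. The field $K_1$ is identified with $K_1\times\{0\}\subset F$, which is contained in the center of $(F,+,\circ)$; dimensions over $K_1$ are with respect to this. The middle nucleus of a semifield $(F,+,\circ)$ is $\mathbb N_m=\{u:(x\circ u)\circ y=x\circ(u\circ y)\ \forall x,y\in F\}$. *)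

(* Defs.v *)
From HB Require Import structures.
From mathcomp Require Import all_boot all_order all_algebra all_fingroup all_field.
From mathcomp Require Import ring.

Set Implicit Arguments.
Unset Strict Implicit.
Unset Printing Implicit Defensive.

Import GRing.Theory.
Local Open Scope ring_scope.

Section Presemifield.

Variables (L : fieldType) (sg : nat) (l n N : L).

(* [sg] is the exponent sigma = p ^ s, so that x^sigma is [x ^+ sg]. *)
Definition h_B (a b c d : L) : L :=
  a * c ^+ sg - n * N * b * d ^+ sg
  + l * (a ^+ sg * c - n * N * b ^+ sg * d)
  + n * (N * a * d ^+ sg - b * c ^+ sg
         + l * (a ^+ sg * d - N * b ^+ sg * c)).

Definition mul_B (x y : L * L) : L * L :=
  (h_B x.1 x.2 y.1 y.2, x.1 * y.2 + x.2 * y.1).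

Definition alpha0 : L :=
  (n ^+ sg - n ^+ 2 * N ^+ 2) / (n * (n * N ^+ 2 - n ^+ sg)).

Definition alpha1 : L :=
  (n ^+ sg + n ^+ 2 * N ^+ 2 - n * N - n ^+ (sg + 1) * N)
  / (n * (n * N ^+ 2 - n ^+ sg)).

Definition alpha2 : L :=
  (n * N * (n ^+ sg - 1)) / (n * (n * N ^+ 2 - n ^+ sg)).

Definition W_map (t : L) : L :=
  (1 + n * alpha0) * t
  + (1 + n * alpha1 + n * N * alpha0 ^+ sg) * t ^+ sg
  + (n * alpha2 + n * N * alpha1 ^+ sg) * t ^+ (sg ^ 2)
  + n * N * alpha2 ^+ sg * t ^+ (sg ^ 3).

End Presemifield.

Definition e_B (L : fieldType) : L * L := (1, 0).

Definition assoc_mul (F : Type) (star : F -> F -> F) (beta gamma : F -> F)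
    (x y : F) : F :=
  beta (star (gamma x) y).

Definition in_middle_nucleus (F : Type) (circ : F -> F -> F) (u : F) : Prop :=
  forall x y, circ (circ x u) y = circ x (circ u y).

Definition has_dim (K : fieldType) (V : vectType K) (S : V -> Prop) (d : nat) :
    Prop :=
  exists U : {vspace V}, (forall v, v \in U <-> S v) /\ \dim U = d.

Section FixedField.

Variables (p s : nat) (pr_p : prime p) (L : fieldExtType 'F_p).
Local Notation sg := (p ^ s)%N.

Fact expr_sgD (x y : L) : (x + y) ^+ sg = x ^+ sg + y ^+ sg.
Proof.
have chL : p \in [pchar L] by rewrite pchar_lalg pchar_Fp.
apply: exprDn_pchar; rewrite pnatX; apply/orP; left.
by rewrite pnatE.
Qed.

Fact expr_sgN (x : L) : (- x) ^+ sg = - x ^+ sg.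
Proof.
apply/eqP; rewrite -addr_eq0 -expr_sgD addNr expr0n.
by rewrite expn_eq0 eqn0Ngt prime_gt0.
Qed.

Fact expr_sgZ (k : 'F_p) (x : L) : (k *: x) ^+ sg = k *: x ^+ sg.
Proof.
rewrite exprZn; congr (_ *: _).
elim: (s) => [|i IHi]; first by rewrite expr1.
rewrite expnS mulnC exprM IHi -[in LHS](natr_Zp k) -[in RHS](natr_Zp k).
have chF : p \in [pchar 'F_p] by rewrite pchar_Fp.
by rewrite -(pFrobenius_autE chF) rmorph_nat.
Qed.

Fact frob_sg_linear : linear (fun x : L => x ^+ sg).
Proof. by move=> k x y; rewrite expr_sgD expr_sgZ. Qed.

Definition frob_sg : {linear L -> L} :=
  HB.pack (fun x : L => x ^+ sg) (GRing.isLinear.Build _ _ _ _ _ frob_sg_linear).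

Definition K1_vspace : {vspace L} := fixedSpace (linfun frob_sg).

Fact mem_K1_vspace (x : L) : (x \in K1_vspace) = (x ^+ sg == x).
Proof. by apply/fixedSpaceP/eqP; rewrite lfunE. Qed.

Fact K1_is_aspace : is_aspace K1_vspace.
Proof.
rewrite /is_aspace has_algid1; last by rewrite mem_K1_vspace expr1n.
apply/prodvP => u v; rewrite !mem_K1_vspace => /eqP uE /eqP vE.
by rewrite exprMn uE vE.
Qed.

Definition K1 : {subfield L} := ASpace K1_is_aspace.

(* L and F = L x L as vector spaces over K1: the carriers are those of L and
   L * L, only the scalars change.  See assoc_mul_scale for the agreement of
   the scalar action on F with the one given by K1 x {0} in (F, +, o). *)
Definition LK : fieldExtType (subvs_of K1) := fieldOver K1.
Definition FK : vectType (subvs_of K1) := (LK * LK)%type.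

Lemma mem_K1 (x : L) : (x \in K1) = (x ^+ sg == x).
Proof. exact: mem_K1_vspace. Qed.

Definition W_space (n N : LK) : {vspace LK} := lker (linfun (W_map sg n N)).

Fact expr_sgK1 (k : subvs_of K1) (x : L) :
  (vsval k * x) ^+ sg = vsval k * x ^+ sg.
Proof. by rewrite exprMn; have := valP k; rewrite mem_K1 => /eqP ->. Qed.

Fact W_map_linear (n N : LK) : linear (W_map sg n N : LK -> LK).
Proof.
move=> k x y; rewrite /W_map.
have E1 (u v : L) : (vsval k * u + v) ^+ sg = vsval k * u ^+ sg + v ^+ sg.
  by rewrite expr_sgD expr_sgK1.
have E (i : nat) (u v : L) :
    (vsval k * u + v) ^+ (sg ^ i) = vsval k * u ^+ (sg ^ i) + v ^+ (sg ^ i).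
  by elim: i u v => [|i IHi] u v; rewrite ?expn0 ?expr1 // expnS !exprM E1 IHi.
have D i : (k *: x + y) ^+ (sg ^ i) = k *: x ^+ (sg ^ i) + y ^+ (sg ^ i).
  exact: E.
have D1 : (k *: x + y) ^+ sg = k *: x ^+ sg + y ^+ sg by exact: E1.
rewrite D1 !D !mulrDr -!scalerAr !scalerDr.
by rewrite [LHS](AC (2*2*2*2) ((1*3*5*7)*(2*4*6*8))).
Qed.

Lemma mem_W_space (n N t : LK) : (t \in W_space n N) = (W_map sg n N t == 0).
Proof.
pose f : {linear LK -> LK} :=
  HB.pack (W_map sg n N : LK -> LK)
    (GRing.isLinear.Build _ _ _ _ _ (W_map_linear n N)).
by rewrite memv_ker; have -> := lfunE f t.
Qed.

Section AssociatedSemifield.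

Variables l n N : L.
Hypotheses (l_neq0 : l != 0) (lP : forall x : L, x ^+ (sg - 1) != - l).
Local Notation star := (mul_B sg l n N).
Local Notation e := (e_B L).

Let sg_gt0 : (0 < sg)%N.
Proof. by rewrite expn_gt0 prime_gt0. Qed.

Let sgS (x : L) : x ^+ sg = x ^+ (sg - 1) * x.
Proof. by rewrite -exprSr subn1 prednK. Qed.

Fact mul_B_eE (x : L * L) :
  star e x = (x.1 ^+ sg + l * x.1 + n * (N * x.2 ^+ sg + l * x.2), x.2).
Proof.
case: x => c d; rewrite /mul_B /h_B /= expr1n expr0n gtn_eqF //=.
by rewrite !(mul0r, mulr0, mul1r, mulr1, subr0, addr0).
Qed.

Fact mul_B_Ee (x : L * L) :
  star x e = (x.1 + l * x.1 ^+ sg - n * (x.2 + l * (N * x.2 ^+ sg)), x.2).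
Proof.
case: x => a b; rewrite /mul_B /h_B /= expr1n expr0n gtn_eqF //=.
rewrite !(mul0r, mulr0, mul1r, mulr1, subr0, addr0, add0r, sub0r).
by rewrite !(mulrN, mulrDr, opprD, mulrA).
Qed.

Fact mul_B_e_inj : injective (star e).
Proof.
case=> a b [c d]; rewrite !mul_B_eE => -[+ /= bd]; rewrite bd => /addIr ac.
congr (_, _); apply/eqP; rewrite -subr_eq0; apply/negPn/negP => nz.
have /eqP[] := lP (a - c); apply: (mulIf nz).
rewrite -sgS expr_sgD expr_sgN mulNr mulrBr opprB.
by apply/eqP; rewrite subr_eq addrAC eq_sym subr_eq addrC ac addrC.
Qed.

Fact mul_B_inj_e : injective (star^~ e).
Proof.
case=> a b [c d] /=; rewrite !mul_B_Ee => -[+ /= bd]; rewrite bd => /addIr ac.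
congr (_, _); apply/eqP; rewrite -subr_eq0; apply/negPn/negP => nz.
have /eqP[] := lP (a - c)^-1.
have E : (a - c) + l * (a - c) ^+ sg = 0.
  by rewrite expr_sgD expr_sgN mulrBr addrACA -opprD ac subrr.
have nz1 : (a - c) ^+ (sg - 1) != 0 by rewrite expf_neq0.
rewrite exprVn; apply: (mulIf nz1); rewrite mulVf //; apply: (mulIf nz).
by rewrite mul1r -mulrA -sgS mulNr; apply/eqP; rewrite -addr_eq0 E.
Qed.

Fact mul_B_scalel (k : subvs_of K1) (x y : FK) :
  star (k *: x : FK) y = k *: (star x y : FK) :> FK.
Proof.
case: x y => a b [c d]; apply/pair_equal_spec; split=> /=; last first.
  rewrite !fieldOver_scaleE; ring.
rewrite /h_B !fieldOver_scaleE !expr_sgK1; ring.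
Qed.

Fact mul_B_scaler (k : subvs_of K1) (x y : FK) :
  star x (k *: y : FK) = k *: (star x y : FK) :> FK.
Proof.
case: x y => a b [c d]; apply/pair_equal_spec; split=> /=; last first.
  rewrite !fieldOver_scaleE; ring.
rewrite /h_B !fieldOver_scaleE !expr_sgK1; ring.
Qed.

Fact mul_B_rlinear (x : FK) : linear (star x : FK -> FK).
Proof.
move=> k [a b] [c d]; rewrite -mul_B_scaler.
case: x (k *: (a, b) : FK) => a1 b1 [a2 b2] /=.
have D (u v : L) := expr_sgD u v; apply/pair_equal_spec; split=> /=; last by ring.
by rewrite /h_B !D; ring.
Qed.

Fact mul_B_llinear (x : FK) : linear (star^~ x : FK -> FK).
Proof.
move=> k [a b] [c d] /=; rewrite -mul_B_scalel.
case: x (k *: (a, b) : FK) => a1 b1 [a2 b2] /=.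
have D (u v : L) := expr_sgD u v; apply/pair_equal_spec; split=> /=; last by ring.
by rewrite /h_B !D; ring.
Qed.

Lemma linear_inj_surj (K : fieldType) (V : vectType K) (f : V -> V) :
  linear f -> injective f -> exists g, forall x, f (g x) = x.
Proof.
move=> f_lin f_inj.
pose F : {linear V -> V} := HB.pack f (GRing.isLinear.Build _ _ _ _ _ f_lin).
have F0 : lker (linfun F) == 0%VS.
  by apply/lker0P => x y; rewrite !lfunE => /f_inj.
exists (linfun F)^-1%VF => x.
by have := lker0_lfunVK F0 x; rewrite lfunE.
Qed.

(* The maps beta and gamma of the associated semifield exist; they are unique
   by mul_B_e_inj and mul_B_inj_e. *)
Lemma assoc_maps_exist :
  exists beta gamma : L * L -> L * L,
    (forall x, star e (beta x) = x) /\ (forall x, star (gamma x) e = star e x).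
Proof.
have [beta betaP] := @linear_inj_surj _ FK _ (mul_B_rlinear e) mul_B_e_inj.
have [g gP] := @linear_inj_surj _ FK _ (mul_B_llinear e) mul_B_inj_e.
by exists beta, (g \o star e); split=> // x; apply: gP.
Qed.

Lemma assoc_mul_scale (beta gamma : L * L -> L * L) :
    (forall x, star e (beta x) = x) ->
    (forall x, star (gamma x) e = star e x) ->
  forall (k : subvs_of K1) (x : FK),
    assoc_mul star beta gamma (vsval k, 0) x = k *: x.
Proof.
move=> betaP gammaP k x.
have -> : ((vsval k, 0) : L * L) = k *: (e : FK).
  by apply/pair_equal_spec; split; rewrite /= fieldOver_scaleE (mulr1, mulr0).
rewrite /assoc_mul; have -> : gamma (k *: (e : FK)) = k *: (e : FK).
  by apply: mul_B_inj_e; rewrite gammaP mul_B_scaler mul_B_scalel.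
by apply: mul_B_e_inj; rewrite betaP mul_B_scalel mul_B_scaler.
Qed.

End AssociatedSemifield.

End FixedField.

Arguments FK {p} s pr_p L.
Arguments W_space {p} s pr_p {L} n N.

(* Main.v *)
From HB Require Import structures.
Require Import Defs.
From mathcomp Require Import all_boot all_order all_algebra all_fingroup all_field.
From mathcomp Require Import ring.

Set Implicit Arguments.
Unset Strict Implicit.
Unset Printing Implicit Defensive.

Import GRing.Theory.
Local Open Scope ring_scope.

(** Write x' for x^sigma.  The elements of the middle nucleus are the values
    B e of the pairs of maps (A, B) with A x * y = x * B y for all x and y
    ([middle_nucleusP]).  The second coordinate ad + bc of the product already
    forces A and B to be L-linear, hence to be determined by the two vectors
    u = B e and v = B (0, 1) ([isotopism_linear]).  The first coordinate is then
    a combination of terms a c' and a' c, which are independent because sigma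
    is not the identity ([frob_bilinear_eq0]); comparing coefficients leaves
    four equations, which express v and v' in terms of u
    ([nucleus_eqs], [isotopismP]).

    These equations say that u.1 + v.2 is fixed by sigma.  Subtracting its half
    k from u.1 (p is odd) leaves t = u.1 - k with
      t + t' + n u.2 + n N u.2' = 0,
    and, given this, the equations amount to
      u.2 = G t,  where  G t = alpha0 t + alpha1 t' + alpha2 t''.
    As the map that defines W is t |-> t + t' + n G t + n N (G t)', the middle
    nucleus is the sum of the line K1 e and of the graph of G over W
    ([nucleus_eqsP]).  The sum is direct: a point (t, G t) of the line has
    t' = t and G t = 0, so that t in W means 2 t = 0.  This yields the
    dimension 1 + dim W ([dim_nucleus_vspace]).

    The bound holds because W is the kernel of a skew polynomial in sigma with
    four coefficients, not all zero ([W_map_coef_neq0]).  Such a kernel has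
    K1-dimension less than the number of coefficients ([dim_skew_root]): a
    nonzero root w allows a division on the right by sigma - w' / w, whose
    kernel is the line K1 w, and induction applies to the quotient. *)

(** * The middle nucleus of an isotopic semifield *)

(** In the semifield itself an element u of the middle nucleus gives the right
    multiplication A and the left multiplication B by u; going back to the
    presemifield conjugates A by gamma and leaves B alone. *)
Lemma middle_nucleusP (F : Type) (star : F -> F -> F) (e : F)
    (beta gamma : F -> F) :
    injective (star e) -> injective (star^~ e) ->
    (forall x, star e (beta x) = x) ->
    (forall x, star (gamma x) e = star e x) ->
  forall u, in_middle_nucleus (assoc_mul star beta gamma) u <->
    exists A B : F -> F,
      (forall x y, star (A x) y = star x (B y)) /\ B e = u.
Proof.
move=> injl injr betaP gammaP u; split=> [nuc_u | [A [B [AB Be]]] x y].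
  have gammaK x : gamma (beta (star x e)) = x.
    by apply: injr; rewrite gammaP betaP.
  exists (fun x => gamma (beta (star x u))), (fun y => beta (star (gamma u) y)).
  split=> [x y|]; last by apply: injl; rewrite betaP gammaP.
  have /(congr1 (star e)) := nuc_u (beta (star x e)) y.
  by rewrite /assoc_mul !betaP gammaK.
have A_E z : gamma (beta (star z u)) = A z.
  by apply: injr; rewrite gammaP betaP AB Be.
have B_E z : beta (star (gamma u) z) = B z.
  apply: injl; rewrite betaP -AB; congr (star _ _).
  by apply: injr; rewrite gammaP AB Be.
by rewrite /assoc_mul A_E B_E AB.
Qed.

(** * Computation in the presemifield *)

Section Presemifield.

Variables (L : fieldType) (sg : nat).
Hypothesis (sg_gt0 : (0 < sg)%N).
Hypothesis sgD : forall x y : L, (x + y) ^+ sg = x ^+ sg + y ^+ sg.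
Local Notation "x ^s" := (x ^+ sg) (at level 2, format "x ^s").

Let sg0 : (0 : L)^s = 0.
Proof. by rewrite expr0n gtn_eqF. Qed.

Let sgN (x : L) : (- x)^s = - x^s.
Proof. by apply/eqP; rewrite -addr_eq0 -sgD addNr sg0. Qed.

Let sgM (x y : L) : (x * y)^s = x^s * y^s.
Proof. exact: exprMn. Qed.

Let sgX2 (x : L) : x ^+ (sg ^ 2) = x^s^s.
Proof. by rewrite -mulnn exprM. Qed.

Let sgX3 (x : L) : x ^+ (sg ^ 3) = x^s^s^s.
Proof. by rewrite expnS exprM sgX2. Qed.

(** The skew polynomial with coefficients c0, c1, ... is the additive map
    t |-> c0 t + c1 t^sigma + ... *)
Fixpoint skew_eval (cs : seq L) (t : L) : L :=
  if cs is c :: cs' then c * t + skew_eval cs' (t^s) else 0.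

Lemma skew_eval0 cs : skew_eval cs 0 = 0.
Proof. by elim: cs => //= c cs IHcs; rewrite mulr0 add0r sg0. Qed.

(** Right division by sigma - a.  The last clause makes up for the fact that a
    skew polynomial is not determined by its values when sigma has small order:
    nonzero coefficients cannot have a zero quotient and a zero remainder. *)
Lemma skew_division (a c : L) (cs : seq L) :
  exists g r, [/\ size g = size cs,
    forall t, skew_eval (c :: cs) t = skew_eval g (t^s - a * t) + r * t
    & all (pred1 0) g -> r = 0 -> all (pred1 0) (c :: cs)].
Proof.
elim: cs a c => [|c' cs IHcs] a c.
  exists [::], c; split=> // [t | _ ->]; last by rewrite /= eqxx.
  by rewrite /= addr0 add0r.
have [g [r [g_size gE g0]]] := IHcs (a^s) c'.
(* Dividing by sigma - a^sigma after one application of sigma is dividing by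
   sigma - a before it: (t^sigma - a t)^sigma = t^sigma^sigma - a^sigma t^sigma. *)
exists (r :: g), (c + r * a); split=> [|t|]; first by rewrite /= g_size.
  rewrite -[LHS]/(c * t + skew_eval (c' :: cs) (t^s)) gE /=.
  by rewrite !(sgD, sgN, sgM); ring.
move=> /andP[/eqP r0 /g0 /(_ r0) cs0]; rewrite r0 mul0r addr0 => c0.
by rewrite -[all _ _]/((c == 0) && all (pred1 0) (c' :: cs)) c0 eqxx.
Qed.

Variables l n N : L.
Hypotheses (l_neq0 : l != 0) (n_neq0 : n != 0) (N_neq0 : N != 0).
Hypothesis sg_neq1 : ~ forall x : L, x^s = x.
Local Notation star := (mul_B sg l n N).

(** Evaluating the second coordinate at (1, 0) and (0, 1) on either side is
    enough to read off both maps. *)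
Lemma isotopism_linear (A B : L * L -> L * L) :
    (forall x y, (A x).1 * y.2 + (A x).2 * y.1
               = x.1 * (B y).2 + x.2 * (B y).1) ->
  let u := B (1, 0) in let v := B (0, 1) in
    (forall x, A x = (x.1 * v.2 + x.2 * v.1, x.1 * u.2 + x.2 * u.1))
 /\ (forall y, B y = (y.1 * u.1 + y.2 * v.1, y.1 * u.2 + y.2 * v.2)).
Proof.
move=> AB u v.
have Av x : (A x).1 = x.1 * v.2 + x.2 * v.1.
  by have := AB x (0, 1); rewrite /= mulr1 mulr0 addr0.
have Au x : (A x).2 = x.1 * u.2 + x.2 * u.1.
  by have := AB x (1, 0); rewrite /= mulr1 mulr0 add0r.
split=> [x | y]; first by rewrite [LHS]surjective_pairing Av Au.
rewrite [LHS]surjective_pairing; congr pair.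
  have := AB (0, 1) y; rewrite Av Au /= !mul0r !mul1r !add0r => <-.
  by rewrite addrC ![y.1 * _]mulrC ![y.2 * _]mulrC.
have := AB (1, 0) y; rewrite Av Au /= !mul0r !mul1r !addr0 => <-.
by rewrite addrC ![y.1 * _]mulrC ![y.2 * _]mulrC.
Qed.

Lemma frob_bilinear_eq0 (X Y : L) :
  (forall a c : L, X * (a * c^s) + Y * (a^s * c) = 0) -> X = 0 /\ Y = 0.
Proof.
move=> XY.
have XYN : Y = - X.
  have := XY 1 1; rewrite expr1n !mulr1 => /eqP.
  by rewrite addrC addr_eq0 => /eqP.
suff X0 : X = 0 by rewrite XYN X0 oppr0.
apply/eqP/negPn/negP => X_neq0; apply: sg_neq1 => x; apply: (mulfI X_neq0).
have := XY x 1; rewrite XYN expr1n !mulr1 mulNr => /eqP.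
by rewrite subr_eq0 => /eqP.
Qed.

(** The coefficients of a c^sigma, b c^sigma, a^sigma c and b^sigma c in the
    first coordinate of A x * y = x * B y; the coefficients of the terms in d
    follow from these. *)
Definition nucleus_eqs (u v : L * L) : Prop :=
  [/\ v.2 = u.1^s + n * u.2 + n * N * u.2^s,
      v.1 = n * u.1 - n * u.1^s - n * N * u.2^s,
      v.2^s = u.1 + n * u.2 + n * N * u.2^s &
      v.1^s = n * N * (u.1^s - u.1 - u.2)].

Lemma isotopismP (u : L * L) :
  (exists A B : L * L -> L * L,
      (forall x y, star (A x) y = star x (B y)) /\ B (1, 0) = u) <->
  exists v, nucleus_eqs u v.
Proof.
split=> [[A [B [AB Be]]] | [v [v2 v1 v2s v1s]]]; last first.
  exists (fun x => (x.1 * v.2 + x.2 * v.1, x.1 * u.2 + x.2 * u.1)).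
  exists (fun y => (y.1 * u.1 + y.2 * v.1, y.1 * u.2 + y.2 * v.2)).
  split=> [[a b] [c d]|]; last by case: (u) => ? ?; rewrite /= !mul0r !mul1r !addr0.
  rewrite /mul_B /=; congr pair; last by ring.
  by rewrite /h_B !(sgD, sgM) v1s v2s v1 v2; ring.
have AB2 x y := congr1 snd (AB x y).
have [] := isotopism_linear AB2; rewrite Be.
set v := B (0, 1) => A_E B_E; exists v.
have AB1 x y := congr1 fst (AB x y).
have [] := @frob_bilinear_eq0
  (v.2 - n * u.2 - u.1^s - n * N * u.2^s)
  (l * (v.2^s - n * N * u.2^s - u.1 - n * u.2)).
  move=> a c; have := AB1 (a, 0) (c, 0); rewrite A_E B_E /= /h_B.
  rewrite !mul0r !addr0 !sgM !sg0 => /eqP; rewrite -subr_eq0 => /eqP <-; ring.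
move=> e1 /eqP; rewrite mulf_eq0 (negPf l_neq0) => /eqP e5.
have [] := @frob_bilinear_eq0
  (v.1 - n * u.1 + n * u.1^s + n * N * u.2^s)
  (l * (v.1^s - n * N * (u.1^s - u.1 - u.2))).
  move=> b c; have := AB1 (0, b) (c, 0); rewrite A_E B_E /= /h_B.
  rewrite !mul0r !add0r !addr0 !sgM !sg0 => /eqP; rewrite -subr_eq0 => /eqP <-; ring.
move=> e3 /eqP; rewrite mulf_eq0 (negPf l_neq0) => /eqP e7.
by split; apply/eqP; rewrite -subr_eq0;
  [rewrite -e1 | rewrite -e3 | rewrite -e5 | rewrite -e7]; apply/eqP; ring.
Qed.

(** The second coordinate of an element of the middle nucleus whose first
    coordinate has been normalized. *)
Definition G_map (t : L) : L :=
  alpha0 sg n N * t + alpha1 sg n N * t^s + alpha2 sg n N * t^s^s.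

Lemma W_mapE (t : L) :
  W_map sg n N t = t + t^s + n * G_map t + n * N * (G_map t)^s.
Proof. by rewrite /W_map /G_map sgX2 sgX3 !(sgD, sgM); ring. Qed.

Hypothesis two_neq0 : (2 : L) != 0.
Hypothesis nN2_neq : n * N ^+ 2 - n^s != 0.

(** The equation on the left involves g^sigma^sigma and g; the hypothesis and
    its image under sigma eliminate g^sigma^sigma and then g^sigma, which leaves
    n (n N^2 - n^sigma) g as a combination of t, t^sigma and t^sigma^sigma. *)
Lemma G_mapP (t g : L) : t + t^s + n * g + n * N * g^s = 0 ->
  n^s * (t^s - t^s^s) - n^s * N^s * g^s^s = n * N * (t^s - t - g)
  <-> g = G_map t.
Proof.
move=> E0; have D_neq0 : n * (n * N ^+ 2 - n^s) != 0 by rewrite mulf_neq0.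
have E1 := congr1 (fun x => x^s) E0; rewrite /= !(sgD, sgM) sg0 in E1.
set lhs := (LHS in LHS = _ <-> _); set rhs := (RHS in _ = RHS <-> _).
have E2 : n * (n * N ^+ 2 - n^s) * (g - G_map t) = n * N * (lhs - rhs).
  transitivity (n * N * (lhs - rhs
      + (t^s + t^s^s + n^s * g^s + n^s * N^s * g^s^s))
    - n^s * (t + t^s + n * g + n * N * g^s)); last by rewrite E0 E1; ring.
  rewrite /lhs /rhs /G_map /alpha0 /alpha1 /alpha2 exprD expr1.
  by field; rewrite nN2_neq n_neq0.
split=> [lr | gG]; apply/eqP; rewrite -subr_eq0.
  have /eqP := E2; rewrite lr subrr mulr0 mulf_eq0 (negPf D_neq0) //.
move/eqP: E2; rewrite gG subrr mulr0 eq_sym !mulf_eq0.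
by rewrite (negPf n_neq0) (negPf N_neq0).
Qed.

(** The scalar k is half of u.1 + v.2, which the equations for v.2 and v.2^sigma
    show to be fixed by sigma. *)
Lemma nucleus_eqsP (u : L * L) :
  (exists v, nucleus_eqs u v) <->
  exists k t, [/\ k^s = k, W_map sg n N t = 0 & u = (k + t, G_map t)].
Proof.
case: u => u1 g; split=> [[[v1 v2]] | [k [t [kK Wt [-> ->]]]]].
  case=> /= v2E v1E v2sE v1sE; pose k := (u1 + v2) / 2; pose t := u1 - k.
  have two_fix : (2 : L)^s = 2 by rewrite sgD expr1n.
  have kK : k^s = k.
    by rewrite sgM exprVn two_fix sgD v2sE /k v2E; congr (_ / _); ring.
  have u1E : u1 = k + t by rewrite /t; ring.
  have Wt : t + t^s + n * g + n * N * g^s = 0.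
    have -> : t^s = u1^s - k by rewrite /t sgD sgN kK.
    have -> : u1^s = v2 - n * g - n * N * g^s by rewrite v2E; ring.
    by rewrite /t /k; field.
  clearbody t k; have gE : g = G_map t.
    apply/(G_mapP Wt); move: v1sE; rewrite v1E u1E !(sgD, sgN, sgM) !kK => E.
    by transitivity (n * N * (k + t^s - (k + t) - g)); [rewrite -E; ring | ring].
  by exists k, t; rewrite W_mapE -gE -u1E.
move: Wt; rewrite W_mapE => Wt.
have [_ /(_ erefl)] := G_mapP Wt; move: (G_map t) Wt => {}g Wt Gt.
exists (n * (k + t) - n * (k + t)^s - n * N * g^s,
        (k + t)^s + n * g + n * N * g^s); split=> //=.
  have := congr1 (fun x => x^s) Wt; rewrite /= !(sgD, sgM) sg0 => Wts.
  rewrite !kK.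
  by transitivity (k - t^s + 0); [rewrite -Wts | rewrite -Wt]; ring.
rewrite !(sgD, sgN, sgM) !kK.
transitivity (n * N * (t^s - t - g)); last by ring.
by rewrite -Gt; ring.
Qed.

(** The last coefficient vanishes only if n^sigma = 1, that is n = 1.  Then
    alpha0 = -1, and the vanishing of the coefficient of t^sigma gives
    N (N - 1)^2 = 0, so N = 1, against n N^2 <> n^sigma. *)
Lemma W_map_coef_neq0 : (forall x : L, x^s = 1 -> x = 1) ->
  ~~ all (pred1 0)
      [:: 1 + n * alpha0 sg n N;
          1 + n * alpha1 sg n N + n * N * (alpha0 sg n N)^s;
          n * alpha2 sg n N + n * N * (alpha1 sg n N)^s;
          n * N * (alpha2 sg n N)^s].
Proof.
move=> sg1; apply/negP => /and5P[_ /= /eqP c1 _ /eqP c3 _].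
have D_neq0 : n * (n * N ^+ 2 - n^s) != 0 by rewrite mulf_neq0.
have n1 : n = 1.
  apply: sg1; move/eqP: c3; rewrite !mulf_eq0 expf_eq0 sg_gt0 /alpha2.
  rewrite !mulf_eq0 invr_eq0 (negPf D_neq0) (negPf n_neq0) (negPf N_neq0) /=.
  by rewrite orbF subr_eq0 => /eqP.
have N2_neq1 : N ^+ 2 - 1 != 0 by move: nN2_neq; rewrite n1 expr1n mul1r.
have a0 : alpha0 sg n N = - 1.
  by rewrite /alpha0 n1 !expr1n !mul1r; field.
move: c1; rewrite a0 sgN /alpha1 n1 !expr1n !mul1r => c1.
have : N * (N - 1) ^+ 2 = 0.
  transitivity (- (N ^+ 2 - 1) * 0); last by rewrite mulr0.
  by rewrite -c1; field.
move/eqP; rewrite mulf_eq0 (negPf N_neq0) expf_eq0 subr_eq0 => /eqP N1.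
by case/negP: N2_neq1; rewrite N1 expr1n subrr.
Qed.

End Presemifield.

(** * Dimensions over the fixed field of sigma *)

Section FixedField.

Variables (p s : nat) (pr_p : prime p) (L : fieldExtType 'F_p).
Local Notation sg := (p ^ s)%N.
Local Notation K := (subvs_of (K1 s pr_p L)).
Local Notation LK := (LK s pr_p L).
Local Notation FK := (FK s pr_p L).

Let sg_gt0 : (0 < sg)%N.
Proof. by rewrite expn_gt0 prime_gt0. Qed.

Let sgD : forall x y : L, (x + y) ^+ sg = x ^+ sg + y ^+ sg.
Proof. by move=> x y; rewrite expr_sgD. Qed.

Lemma frob_sub_linear (a : LK) : linear (fun t : LK => t ^+ sg - a * t : LK).
Proof.
move=> k x y.
have -> : (k *: x + y) ^+ sg = k *: x ^+ sg + y ^+ sg.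
  have := sgD (vsval k * x) y; rewrite expr_sgK1; exact.
rewrite mulrDr -scalerAr scalerBr opprD addrACA; exact.
Qed.

Definition frob_sub (a : LK) : 'End(LK) :=
  linfun (HB.pack (fun t : LK => t ^+ sg - a * t : LK)
    (GRing.isLinear.Build _ _ _ _ _ (frob_sub_linear a)) : {linear LK -> LK}).

Lemma frob_subE (a t : LK) : frob_sub a t = t ^+ sg - a * t.
Proof. by rewrite lfunE. Qed.

(** If t^sigma = (w^sigma / w) t then t / w is fixed by sigma. *)
Lemma lker_frob_sub (w : LK) : w != 0 ->
  (lker (frob_sub (w ^+ sg / w)) <= <[w]>)%VS.
Proof.
move=> w_neq0; apply/subvP => t; rewrite memv_ker frob_subE subr_eq0 => /eqP tE.
have tw_K1 : (t / w : L) \in K1 s pr_p L.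
  rewrite mem_K1; apply/eqP.
  have : (t / w) ^+ sg = t / w :> LK.
    by rewrite exprMn exprVn tE; field; rewrite w_neq0 expf_neq0.
  exact.
apply/vlineP; exists (Subvs tw_K1).
by have := fieldOver_scaleE (Subvs tw_K1) w => ->; rewrite /= divfK.
Qed.

(** Counting the roots of the ordinary polynomial would give a weaker bound, as
    the fixed field K1 of sigma may have fewer than p^s elements.  For a nonzero
    root w, the map sigma - w^sigma / w maps the kernel to the kernel of the
    quotient by it and loses at most one dimension. *)
Lemma dim_skew_root (cs : seq L) (U : {vspace LK}) :
    ~~ all (pred1 0) cs -> (forall u : L, u \in U -> skew_eval sg cs u = 0) ->
  (\dim U < size cs)%N.
Proof.
elim: {cs}(size cs) {-2}cs (erefl (size cs)) U => [|d IHd] [|c cs] //= [cs_d] U.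
move=> cs_neq0 U_root.
have [->|U_neq0] := eqVneq U 0%VS; first by rewrite dimv0.
have w_neq0 : vpick U != 0 by rewrite vpick0.
have wU : vpick U \in U by apply: memv_pick.
set w := vpick U in w_neq0 wU.
have [g [r [g_size gE g_neq0]]] :=
  skew_division sg_gt0 sgD (w ^+ sg / w : LK) c cs.
have gwE (t : LK) :
    skew_eval sg (c :: cs) t = skew_eval sg g (frob_sub (w ^+ sg / w) t) + r * t.
  by rewrite frob_subE; apply: gE.
have r0 : r = 0.
  have := U_root w wU; rewrite -[LHS]/(skew_eval sg (c :: cs) w) gwE frob_subE.
  rewrite divfK // subrr skew_eval0 // add0r => /eqP.
  by rewrite mulf_eq0 => /orP[/eqP | /negPn]; last rewrite w_neq0.
set phi := frob_sub (w ^+ sg / w) in gwE.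
have ker_le1 : (\dim (U :&: lker phi) <= 1)%N.
  apply: leq_trans (dimvS (subv_trans (capvSr _ _) (lker_frob_sub w_neq0))) _.
  by rewrite dim_vline w_neq0.
have img_lt : (\dim (phi @: U) < size g)%N.
  apply: IHd => [||_ /memv_imgP[t tU ->]]; first by rewrite g_size.
    by apply: contra cs_neq0 => /g_neq0 /(_ r0).
  by have := gwE t; rewrite r0 mul0r addr0 => <-; apply: U_root.
rewrite -(limg_ker_dim phi U) -addnS -g_size -add1n.
exact: leq_add ker_le1 img_lt.
Qed.

Lemma G_graph_linear (n N : L) :
  linear (fun t : LK => (t, G_map sg n N t) : FK).
Proof.
move=> k x y; congr pair; rewrite /G_map.
have -> : (k *: x + y : LK) = vsval k * (x : L) + y :> L by [].
rewrite !(sgD, expr_sgK1).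
have sc (a : L) : (k *: (a : LK) : LK) = vsval k * a :> L by exact: fieldOver_scaleE.
rewrite -[RHS]/(k *: (G_map sg n N x : LK) + G_map sg n N y :> L) sc /G_map.
by ring.
Qed.

Definition G_graph (n N : L) : 'Hom(LK, FK) :=
  linfun (HB.pack (fun t : LK => (t, G_map sg n N t) : FK)
    (GRing.isLinear.Build _ _ _ _ _ (G_graph_linear n N)) : {linear LK -> FK}).

Lemma G_graphE (n N : L) (t : LK) : G_graph n N t = (t, G_map sg n N t).
Proof. by rewrite lfunE. Qed.

Definition nucleus_vspace (n N : L) : {vspace FK} :=
  (<[e_B L : FK]> + G_graph n N @: W_space s pr_p n N)%VS.

Lemma scale_e_B (k : K) : (k *: (e_B L : FK) : FK) = (vsval k, 0) :> L * L.
Proof.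
congr pair.
  by have := fieldOver_scaleE k (1 : L) => /= ->; rewrite mulr1.
by have := fieldOver_scaleE k (0 : L) => /= ->; rewrite mulr0.
Qed.

Lemma nucleus_vspaceP (n N : L) (u : L * L) :
  reflect (exists k t,
             [/\ k ^+ sg = k, W_map sg n N t = 0 & u = (k + t, G_map sg n N t)])
          ((u : FK) \in nucleus_vspace n N).
Proof.
apply: (iffP memv_addP).
  case=> _ /vlineP[k ->] [_ /memv_imgP[t Wt ->] ->].
  exists (vsval k), t; split.
  - by apply/eqP; have := valP k; rewrite mem_K1.
  - by apply/eqP; rewrite mem_W_space in Wt.
  by rewrite scale_e_B G_graphE; congr pair; exact: add0r.
case=> k [t [kK Wt ->]].
have kK1 : k \in K1 s pr_p L by rewrite mem_K1 kK.
exists (Subvs kK1 *: (e_B L : FK)); first by apply: memvZ; apply: memv_line.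
exists (G_graph n N t).
  by apply: memv_img; rewrite mem_W_space; apply/eqP.
by rewrite scale_e_B G_graphE; congr pair; rewrite add0r.
Qed.

Lemma dim_nucleus_vspace (n N : L) : (2 : L) != 0 ->
  \dim (nucleus_vspace n N) = (1 + \dim (W_space s pr_p n N))%N.
Proof.
move=> two_neq0.
have e_neq0 : (e_B L : FK) != 0 by rewrite xpair_eqE negb_and oner_eq0.
rewrite /nucleus_vspace dimv_disjoint_sum.
  rewrite dim_vline e_neq0 limg_dim_eq //; apply/eqP; rewrite -subv0.
  apply/subvP => t /memv_capP[_]; rewrite memv_ker G_graphE memv0.
  by rewrite xpair_eqE => /andP[].
apply/eqP; rewrite -subv0.
apply/subvP => _ /memv_capP[/vlineP[k ->] /memv_imgP[t Wt]].
rewrite scale_e_B G_graphE => -[kt Gt].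
suff t0 : t = 0 by rewrite memv0 kt t0 xpair_eqE !eqxx.
have ts : (t : L) ^+ sg = t.
  by rewrite -kt; apply/eqP; have := valP k; rewrite mem_K1.
have : (2 : L) * t = 0.
  move: Wt; rewrite mem_W_space => /eqP Wt; rewrite -[RHS]Wt.
  rewrite -[RHS]/(W_map sg n N (t : L)) W_mapE // -Gt ts expr0n gtn_eqF //.
  by rewrite !mulr0 !addr0; ring.
by move/eqP; rewrite mulf_eq0 (negPf two_neq0) => /eqP.
Qed.

End FixedField.

(* L is a field with p ^ m elements, given as an extension of 'F_p of degree m. *)
Theorem theorem8p25 (p m s : nat) (pr_p : prime p) (odd_p : odd p)
    (L : fieldExtType 'F_p) (dimL : \dim {:L} = m)
    (s_gt0 : (0 < s)%N) (s_ltm : (s < m)%N)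
    (l n N : L) (l_neq0 : l != 0) (n_neq0 : n != 0) (N_neq0 : N != 0)
    (l_cond : forall x : L, x ^+ (p ^ s - 1)%N != - l)
    (nN_cond : forall x : L,
       x ^+ (p ^ s + 1)%N + (1 - 1 / N) * x + (1 / n - 1) / N != 0)
    (n_neqN : n ^+ (p ^ s - 1)%N != N)
    (n_neqN2 : n ^+ (p ^ s - 1)%N != N ^+ 2)
    (sg2_neq1 : ~ (forall x : L, x ^+ ((p ^ s) ^ 2)%N = x))
    (beta gamma : L * L -> L * L)
    (betaP : forall x, mul_B (p ^ s)%N l n N (e_B L) (beta x) = x)
    (gammaP : forall x,
       mul_B (p ^ s)%N l n N (gamma x) (e_B L) = mul_B (p ^ s)%N l n N (e_B L) x) :
  has_dim (V := FK s pr_p L)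
    (in_middle_nucleus (assoc_mul (mul_B (p ^ s)%N l n N) beta gamma))
    (1 + \dim (W_space s pr_p n N))%N
  /\ (1 + \dim (W_space s pr_p n N) <= 4)%N.
Proof.
have sg_gt0 : (0 < p ^ s)%N by rewrite expn_gt0 prime_gt0.
have sgD (x y : L) := expr_sgD s pr_p x y.
have two_neq0 : (2 : L) != 0.
  have chL : p \in [pchar L] by rewrite pchar_lalg pchar_Fp.
  rewrite -(dvdn_pcharf chL) gtnNdvd //.
  by rewrite ltn_neqAle prime_gt1 // andbT; apply: contraL odd_p => /eqP <-.
have sg_neq1 : ~ forall x : L, x ^+ (p ^ s) = x.
  by move=> sg1; apply: sg2_neq1 => x; rewrite -mulnn exprM !sg1.
have nN2_neq : n * N ^+ 2 - n ^+ (p ^ s) != 0.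
  apply: contra n_neqN2; rewrite subr_eq0 -[X in n ^+ X](subnK sg_gt0) addn1.
  by rewrite [n ^+ _]exprS (inj_eq (mulfI n_neq0)) eq_sym.
have injl := mul_B_e_inj pr_p l_cond; have injr := mul_B_inj_e pr_p l_cond.
split.
  exists (nucleus_vspace s pr_p n N); split; last exact: dim_nucleus_vspace.
  move=> u; rewrite (middle_nucleusP (injl n N) (injr n N) betaP gammaP).
  rewrite isotopismP // nucleus_eqsP //.
  exact: iff_sym (rwP (nucleus_vspaceP s pr_p n N u)).
have sg1 (x : L) : x ^+ (p ^ s) = 1 -> x = 1.
  move=> x1; apply/eqP; rewrite -subr_eq0.
  have : (x - 1) ^+ (p ^ s) = 0 by rewrite sgD expr_sgN // x1 expr1n subrr.
  by move/eqP; rewrite expf_eq0 sg_gt0.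
rewrite add1n.
have coef_neq0 := W_map_coef_neq0 sg_gt0 sgD n_neq0 N_neq0 nN2_neq sg1.
apply: (dim_skew_root coef_neq0) => t; rewrite mem_W_space => /eqP <-.
rewrite -[RHS]/(W_map (p ^ s) n N (t : L)) /W_map /= -mulnn exprM.
by rewrite expnS exprM -mulnn exprM; ring.
Qed.
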